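(* Let $\mathcal P$ be the generic countable homogeneous partial order. The isomorphism relation on the class of countable partial orders is Borel reducible to the conjugacy relation on $\mathrm{Aut}(\mathcal P)$. Hence the conjugacy relation on $\mathrm{Aut}(\mathcal P)$ is Borel complete.
   Context: $\mathcal P$ is the Fraïssé limit of the class of finite partial orders: the unique (up to isomorphism) countable partial order that is homogeneous (every isomorphism between finite suborders extends to an automorphism) and contains a copy of every finite partial order. Countable partial orders are coded as binary relations on $\mathbb N$, forming a standard Borel space. $\mathrm{Aut}(\mathcal P)$ is a Polish group, and its conjugacy relation is $\phi\sim\psi$ iff $\alpha\phi\alpha^{-1}=\psi$ for some $\alpha\in\mathrm{Aut}(\mathcal P)$. For equivalence relations $E,F$ on standard Borel spaces $X,Y$, $E$ is Borel reducible to $F$ if there is a Borel $f\colon X\to Y$ with $x\mathrel{E}x'\iff f(x)\mathrel{F}f(x')$. $E$ is Borel complete if it is Borel reducible to the isomorphism relation on some class of countable structures and the isomorphism relation on every class of countable structures is Borel reducible to $E$. *)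

(* Defs.v *)
From HB Require Import structures.
From mathcomp Require Import all_boot all_order.
From mathcomp Require Import boolp classical_sets measurable_structure.

Set Implicit Arguments.
Unset Strict Implicit.
Unset Printing Implicit Defensive.

Local Open Scope classical_set_scope.

(* Borel structures.  All spaces below are countable products of countable
   discrete spaces; their Borel sigma-algebra (for the product topology) is
   the sigma-algebra generated by the basic cylinder sets, which is how we
   define it.                                                          *)

(* The space 2^(N x N) of binary relations on N (codes of countable
   structures with one binary relation, universe N). *)
Definition relspace := nat -> nat -> bool.
Definition rel_borel : set (set relspace) :=
  <<s [set A | exists i j b, A = [set x : relspace | x i j = b]] >>.

Definition baire := nat -> nat.
Definition baire_borel : set (set baire) :=
  <<s [set A | exists n m, A = [set f : baire | f n = m]] >>.

(* A countable relational language: a countable index set I with arities;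
   the space X_L of L-structures with universe N. *)
Definition struct_space (I : countType) (ar : I -> nat) :=
  forall i : I, (ar i).-tuple nat -> bool.
Definition struct_borel (I : countType) (ar : I -> nat)
  : set (set (struct_space ar)) :=
  <<s [set A | exists (i : I) (t : (ar i).-tuple nat) (b : bool),
        A = [set x : struct_space ar | x i t = b]] >>.

Definition struct_iso (I : countType) (ar : I -> nat)
    (x y : struct_space ar) : Prop :=
  exists g : nat -> nat, bijective g /\
    forall (i : I) (t : (ar i).-tuple nat), x i t = y i (map_tuple g t).

Definition struct_class (I : countType) (ar : I -> nat)
    (C : set (struct_space ar)) : Prop :=
  @struct_borel I ar C /\
  forall x y, struct_iso x y -> C x -> C y.

(* Borel reducibility of E (on the Borel subset DX of X) to F (on the
   Borel subset DY of Y): a map f, Borel on DX (with the subspace Borel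
   structure), mapping DX into DY, with  x E x' <-> f x F f x'.          *)
Definition borel_reducible (X Y : Type)
    (sX : set (set X)) (DX : set X) (E : X -> X -> Prop)
    (sY : set (set Y)) (DY : set Y) (F : Y -> Y -> Prop) : Prop :=
  exists f : X -> Y,
    (forall x, DX x -> DY (f x)) /\
    (forall B, sY B -> sX (DX `&` f @^-1` B)) /\
    (forall x x', DX x -> DX x' -> (E x x' <-> F (f x) (f x'))).

Definition borel_complete (Y : Type) (sY : set (set Y)) (DY : set Y)
    (E : Y -> Y -> Prop) : Prop :=
  (exists (I : countType) (ar : I -> nat) (C : set (struct_space ar)),
      @struct_class I ar C /\
      borel_reducible sY DY E (@struct_borel I ar) C (@struct_iso I ar)) /\
  (forall (I : countType) (ar : I -> nat) (C : set (struct_space ar)),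
      @struct_class I ar C ->
      borel_reducible (@struct_borel I ar) C (@struct_iso I ar) sY DY E).

Definition is_porder (R : relspace) : Prop :=
  (forall x, R x x) /\
  (forall x y, R x y -> R y x -> x = y) /\
  (forall x y z, R x y -> R y z -> R x z).

Definition is_fin_porder (n : nat) (r : rel 'I_n) : Prop :=
  (forall x, r x x) /\
  (forall x y, r x y -> r y x -> x = y) /\
  (forall x y z, r x y -> r y z -> r x z).

Definition porder_iso (R S : relspace) : Prop :=
  exists g : nat -> nat, bijective g /\ forall x y, R x y = S (g x) (g y).

Definition is_aut (P : relspace) (a : baire) : Prop :=
  bijective a /\ forall x y, P x y = P (a x) (a y).

(* Conjugacy in Aut(P): psi = alpha o phi o alpha^-1 for some alpha in
   Aut(P), i.e. alpha o phi = psi o alpha. *)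
Definition aut_conj (P : relspace) (phi psi : baire) : Prop :=
  exists alpha : baire, is_aut P alpha /\ forall x, alpha (phi x) = psi (alpha x).

Definition homogeneous (P : relspace) : Prop :=
  forall (s : seq nat) (h : nat -> nat),
    {in s &, injective h} ->
    {in s &, forall x y, P x y = P (h x) (h y)} ->
    exists alpha : baire, is_aut P alpha /\ {in s, forall x, alpha x = h x}.

Definition fin_universal (P : relspace) : Prop :=
  forall (n : nat) (r : rel 'I_n), is_fin_porder r ->
    exists e : 'I_n -> nat, injective e /\ forall i j, r i j = P (e i) (e j).

(* The Fraisse limit of finite partial orders (characterized up to
   isomorphism as the countable homogeneous partial order containing a copy
   of every finite partial order). *)
Definition generic_porder (P : relspace) : Prop :=
  is_porder P /\ homogeneous P /\ fin_universal P.

(* Main.v *)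
Require Import Defs.
From mathcomp Require Import all_boot all_order zify.
From mathcomp Require Import boolp classical_sets measurable_structure.

Set Implicit Arguments.
Unset Strict Implicit.
Unset Printing Implicit Defensive.

Local Open Scope classical_set_scope.

(* Given a countable partial order L, adjoin freely, and iterate omega times, a
   point above A and below B for all finite sets A < B, each in infinitely many
   copies grouped in pairs.  The result has the one-point extension property, so it
   is isomorphic to P by back-and-forth, and swapping all pairs at once is an
   automorphism whose set of fixed points is exactly L.  The construction is
   functorial in L, so isomorphic orders give conjugate automorphisms, while
   conjugate automorphisms have isomorphic sets of fixed points.  Choosing least
   witnesses in the back-and-forth makes the map Borel.  A countable structure is
   coded by a partial order on a fixed universe, in which a definable chain of type
   omega serves to colour the other points; and phi is coded by (P, graph of phi). *)

(** * Measurability on a Borel subset *)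

Section TraceMeasurability.
Variables (X : Type) (sX : set (set X)) (D : set X).
Hypotheses (sigmaX : sigma_algebra setT sX) (sD : sX D).

(** Only the trace on [D] has to be measurable, as in [borel_reducible]; the behaviour of [Q] off
    [D] is free. *)
Definition trace_meas (Q : X -> Prop) : Prop := sX (D `&` Q).

Lemma trace_meas_ext (Q Q' : X -> Prop) :
  (forall x, D x -> (Q x <-> Q' x)) -> trace_meas Q -> trace_meas Q'.
Proof.
move=> QQ'; suff -> : trace_meas Q = trace_meas Q' by [].
congr (sX _); apply/seteqP; split => x [Dx Qx]; split => //; exact/(QQ' _ Dx).
Qed.

Lemma sigma_algebra_setI A B : sX A -> sX B -> sX (A `&` B).
Proof.
case: sigmaX => _ sC sU sA sB.
have -> : A `&` B = setT `\` \bigcup_k (if k == 0%N then setT `\` A else setT `\` B).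
  apply/seteqP; split => x.
    move=> [Ax Bx]; split => // -[[|k] _ /=] [_]; exact.
  move=> [_ nU]; split; apply: contrapT => h; apply: nU.
    by exists 0%N.
  by exists 1%N.
by apply: (sC); apply: sU => -[|k] /=; apply: sC.
Qed.

Lemma trace_meas_not Q : trace_meas Q -> trace_meas (fun x => ~ Q x).
Proof.
case: (sigmaX) => _ sC _ sQ; rewrite /trace_meas.
have -> : D `&` (fun x => ~ Q x) = D `&` (setT `\` (D `&` Q)).
  apply/seteqP; split => x [Dx h]; split => //.
    by split => // -[].
  by move=> Qx; case: h => _; apply.
by apply: sigma_algebra_setI => //; apply: sC.
Qed.

Lemma trace_meas_const (q : Prop) : trace_meas (fun=> q).
Proof.
case: (sigmaX) => s0 _ _; rewrite /trace_meas.
case: (pselect q) => hq.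
  by have -> : D `&` (fun=> q) = D by apply/seteqP; split => x // [].
by have -> : D `&` (fun=> q) = set0 by apply/seteqP; split => x // [].
Qed.

Lemma trace_meas_ex (V : countType) (Q : V -> X -> Prop) :
  (forall v, trace_meas (Q v)) -> trace_meas (fun x => exists v, Q v x).
Proof.
case: (sigmaX) => s0 _ sU sQ; rewrite /trace_meas.
have -> : D `&` (fun x => exists v, Q v x) =
    \bigcup_k (if @unpickle V k is Some v then D `&` Q v else set0).
  apply/seteqP; split => x.
    by move=> [Dx [v Qv]]; exists (pickle v) => //=; rewrite pickleK.
  move=> [k _ /=]; case: (unpickle k) => [v|//] [Dx Qv]; split => //; by exists v.
by apply: sU => k; case: (unpickle k).
Qed.

Lemma trace_meas_all (V : countType) (Q : V -> X -> Prop) :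
  (forall v, trace_meas (Q v)) -> trace_meas (fun x => forall v, Q v x).
Proof.
move=> sQ; apply: (@trace_meas_ext (fun x => ~ exists v, ~ Q v x)).
  move=> x _; split => [h v|h [v]]; last exact.
  by apply: contrapT => nQ; apply: h; exists v.
by apply: trace_meas_not; apply: trace_meas_ex => v; apply: trace_meas_not.
Qed.

Lemma trace_meas_and Q Q' :
  trace_meas Q -> trace_meas Q' -> trace_meas (fun x => Q x /\ Q' x).
Proof.
move=> sQ sQ'; apply: (@trace_meas_ext (fun x => forall b : bool, if b then Q x else Q' x)).
  by move=> x _; split => [h|[? ?] []] //; split; [exact: (h true)|exact: (h false)].
by apply: trace_meas_all => -[].
Qed.

Lemma trace_meas_or Q Q' :
  trace_meas Q -> trace_meas Q' -> trace_meas (fun x => Q x \/ Q' x).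
Proof.
move=> sQ sQ'; apply: (@trace_meas_ext (fun x => exists b : bool, if b then Q x else Q' x)).
  move=> x _; split => [[[] ?]|[?|?]]; [by left|by right|by exists true|by exists false].
by apply: trace_meas_ex => -[].
Qed.

Lemma trace_meas_imp Q Q' :
  trace_meas Q -> trace_meas Q' -> trace_meas (fun x => Q x -> Q' x).
Proof.
move=> sQ sQ'; apply: (@trace_meas_ext (fun x => ~ Q x \/ Q' x)).
  move=> x _; split => [[//|//]|h].
  by case: (pselect (Q x)) => q; [right; apply: h|left].
by apply: trace_meas_or => //; apply: trace_meas_not.
Qed.

Lemma trace_meas_iff Q Q' :
  trace_meas Q -> trace_meas Q' -> trace_meas (fun x => Q x <-> Q' x).
Proof. by move=> ? ?; apply: trace_meas_and; apply: trace_meas_imp. Qed.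

(** The witness of least [pickle] code is chosen, and [v0] where there is none. That [v] is chosen
    is then a countable Boolean combination of the conditions [W x v']. *)
Lemma measurable_selection (V : countType) (v0 : V) (W : X -> V -> Prop) :
  (forall v, trace_meas (fun x => W x v)) ->
  exists c : X -> V, (forall v, trace_meas (fun x => c x = v)) /\
    (forall x, (exists v, W x v) -> W x (c x)).
Proof.
move=> sW.
pose M x v := (W x v /\ forall v', (pickle v' < pickle v)%N -> ~ W x v').
pose N x v := M x v \/ ((forall v', ~ W x v') /\ v = v0).
have Mex x : (exists v, W x v) -> exists v, M x v.
  move=> [v]; have [n] := ubnP (pickle v); elim: n v => // n IH v ltn Wv.
  case: (pselect (exists2 v', (pickle v' < pickle v)%N & W x v')).
    by move=> [v' lt Wv']; apply: (IH v') => //; apply: leq_trans lt _.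
  by move=> h; exists v; split => // v' lt Wv'; apply: h; exists v'.
have Nex x : exists v, N x v.
  case: (pselect (exists v, W x v)) => [/Mex [v Mv]|h]; first by exists v; left.
  by exists v0; right; split => // v' Wv'; apply: h; exists v'.
have Nuniq x v v' : N x v -> N x v' -> v = v'.
  case=> [[Wv mv]|[nW ->]] [[Wv' mv']|[nW' ->]] //; last 2 first.
  - by case: (nW' v).
  - by case: (nW v').
  case: (ltngtP (pickle v) (pickle v')) => [/mv'//|/mv//|].
  by move/(pcan_inj (@pickleK V)).
have [c cN] := choice Nex.
exists c; split.
  move=> v; apply: (@trace_meas_ext (fun x => N x v)).
    by move=> x _; split => [/(Nuniq _ _ _ (cN x))|<-].
  apply: trace_meas_or.
    apply: trace_meas_and => //; apply: trace_meas_all => v'.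
    by apply: trace_meas_imp; [exact: trace_meas_const|exact: trace_meas_not].
  apply: trace_meas_and; last exact: trace_meas_const.
  by apply: trace_meas_all => v'; apply: trace_meas_not.
move=> x [v Wv]; case: (cN x) => [[]//|[nW _]]; by case: (nW v).
Qed.

Lemma trace_meas_preimage (Y : Type) (G : set (set Y)) (f : X -> Y) :
  (forall A, G A -> trace_meas (fun x => A (f x))) ->
  forall B, <<s G >> B -> sX (D `&` f @^-1` B).
Proof.
move=> fG; apply: smallest_sub; last exact: fG.
split.
- by have := trace_meas_const False; congr (sX _).
- move=> A sA; have := trace_meas_not sA.
  by apply: trace_meas_ext => x _; split => [h|[]].
- move=> A sA; have := @trace_meas_ex nat (fun k x => A k (f x)) sA.
  by apply: trace_meas_ext => x _; split => [[k]|[k _]]; exists k.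
Qed.

End TraceMeasurability.

(** * Free one-point extensions *)

Definition partial_order (T : Type) (le : T -> T -> Prop) : Prop :=
  [/\ forall x, le x x, forall x y, le x y -> le y x -> x = y &
      forall y x z, le x y -> le y z -> le x z].

Definition order_iso (T S : Type) (le : T -> T -> Prop) (le' : S -> S -> Prop)
    (g : T -> S) : Prop :=
  bijective g /\ forall x y, le x y <-> le' (g x) (g y).

(* [lo] and [hi] prescribe the type of a new point over the finite set [s]. *)
Definition one_point_extension (T : eqType) (le : T -> T -> Prop) : Prop :=
  forall (s : seq T) (lo hi : pred T),
    {in s &, forall a b, lo a -> hi b -> le a b /\ a <> b} ->
    {in s &, forall a c, lo a -> le c a -> lo c} ->
    {in s &, forall b c, hi b -> le b c -> hi c} ->
    exists z, {in s, forall c, (le c z <-> lo c) /\ (le z c <-> hi c)}.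

Section FreeExtension.
Variables (U : countType).
Import GenTree.
Local Notation tree := (GenTree.tree U).

(** Counting the label lets a new point outweigh any finite set of points; giving leaves size 0
    makes every tree no larger than a leaf a leaf. *)
Fixpoint tree_size (t : tree) : nat :=
  if t is Node n s then (n + sumn (map tree_size s)).+1 else 0.

(* The tree [Node n [:: Node _ A; Node _ B]] names a generic point above [A]
   and below [B]; trees of any other shape name points with [A = B = [::]].
   The label [n] provides arbitrarily large trees over given [A], [B]. *)
Definition lower (t : tree) : seq tree :=
  if t is Node _ [:: Node _ A; Node _ _] then A else [::].
Definition upper (t : tree) : seq tree :=
  if t is Node _ [:: Node _ _; Node _ B] then B else [::].

Lemma mem_sumn_map (s : seq tree) t : t \in s -> tree_size t <= sumn (map tree_size s).
Proof.
elim: s => //= a s IH; rewrite in_cons => /orP [/eqP -> | /IH h]; first exact: leq_addr.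
by apply: leq_trans h _; exact: leq_addl.
Qed.

Lemma tree_size_lower t a : a \in lower t -> tree_size a < tree_size t.
Proof.
by case: t => [//|n [//|[//|m A] [//|[//|k B] [|//]]]] /= /mem_sumn_map; lia.
Qed.

Lemma tree_size_upper t a : a \in upper t -> tree_size a < tree_size t.
Proof.
by case: t => [//|n [//|[//|m A] [//|[//|k B] [|//]]]] /= /mem_sumn_map; lia.
Qed.

(** A bound on the sum, not just on each size: it lets inductions on a sum of sizes replace [t] by
    the pair [a], [b]. *)
Lemma tree_size_lower_upper t a b :
  a \in lower t -> b \in upper t -> tree_size a + tree_size b < tree_size t.
Proof.
case: t => [//|n [//|[//|m A] [//|[//|k B] [|//]]]] /= /mem_sumn_map hA /mem_sumn_map; lia.
Qed.

Section Order.
Variable R : U -> U -> Prop.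

(** A tree passes comparisons on only if its lower set is already below its upper set, so this
    condition is part of the recursion. It occurs strictly positively; strictness is expressed by
    disjointness of lists, which avoids a negated [tree_le]. *)
Inductive tree_le : tree -> tree -> Prop :=
| TreeLeLeaf u v : R u v -> tree_le (Leaf u) (Leaf v)
| TreeLeRefl t : tree_le t t
| TreeLeLower x y a : a \in lower y ->
    (forall a' b', a' \in lower y -> b' \in upper y -> tree_le a' b') ->
    (forall a', a' \in lower y -> a' \notin upper y) ->
    tree_le x a -> tree_le x y
| TreeLeUpper x y b : b \in upper x ->
    (forall a' b', a' \in lower x -> b' \in upper x -> tree_le a' b') ->
    (forall a', a' \in lower x -> a' \notin upper x) ->
    tree_le b y -> tree_le x y.

(* Without strictness of [lower t < upper t] antisymmetry fails; an inconsistent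
   [t] is comparable only to itself. *)
Definition consistent t : Prop :=
  (forall a b, a \in lower t -> b \in upper t -> tree_le a b) /\
  (forall a, a \in lower t -> a \notin upper t).

Lemma tree_leE x y : tree_le x y <->
  [\/ exists u v, [/\ x = Leaf u, y = Leaf v & R u v], x = y,
      consistent y /\ exists2 a, a \in lower y & tree_le x a |
      consistent x /\ exists2 b, b \in upper x & tree_le b y].
Proof.
split.
  case=> [u v Ruv|t|{}x {}y a ay c1 c2 xa|{}x {}y b bx c1 c2 xb].
  - by constructor 1; exists u, v.
  - by constructor 2.
  - by constructor 3; split => //; exists a.
  - by constructor 4; split => //; exists b.
case=> [[u [v [-> -> Ruv]]]|->|[[c1 c2] [a ay xa]]|[[c1 c2] [b bx by_]]].
- exact: TreeLeLeaf.
- exact: TreeLeRefl.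
- exact: TreeLeLower xa.
- exact: TreeLeUpper by_.
Qed.

Hypothesis Rorder : partial_order R.

(** Cut elimination by induction on the total size. Outer steps are peeled off until the comparisons
    meet at [y], as [x <= a] with [a] in [lower y] and [b <= z] with [b] in [upper y]; consistency
    of [y] gives [a <= b], and two smaller instances finish. *)
Lemma tree_le_trans y x z : tree_le x y -> tree_le y z -> tree_le x z.
Proof.
have [n] := ubnP (tree_size x + tree_size y + tree_size z).
elim: n x y z => // n IH x y z size_lt xy yz.
move: (xy) (yz) => /tree_leE xyE /tree_leE yzE.
case: xyE => [[u [v [xu yv Ruv]]]|->//|[cy [a ay xa]]|[[cx1 cx2] [b bx le_by]]]; last first.
- apply: (TreeLeUpper bx cx1 cx2); apply: (IH _ y) => //.
  by have := tree_size_upper bx; lia.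
- case: yzE => [[u [v [yu _ _]]]|<-//|[[cz1 cz2] [c cz yc]]|[_ [b b_y bz]]].
  + by rewrite yu in ay.
  + apply: (TreeLeLower cz cz1 cz2); apply: (IH _ y) => //.
    by have := tree_size_lower cz; lia.
  + have := tree_size_lower_upper ay b_y; have := tree_size_upper b_y => s1 s2.
    apply: (IH _ b) => //; first lia.
    by apply: (IH _ a) => //; [lia|exact: cy.1].
- case: yzE => [[v' [w [yv' zw Rvw]]]|<-//|[[cz1 cz2] [c cz yc]]|[_ [b b_y bz]]].
  + move: yv' Rvw; rewrite yv => -[<-] Rvw; rewrite xu zw.
    by apply: TreeLeLeaf; case: Rorder => _ _; apply; [exact: Ruv|].
  + apply: (TreeLeLower cz cz1 cz2); apply: (IH _ y) => //.
    by have := tree_size_lower cz; lia.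
  + by rewrite yv in b_y.
Qed.

(* A point is freely generated over the points of smaller size. *)
Lemma tree_le_Node_lower n s y : let x := Node n s in
  tree_le y x -> y <> x -> tree_size y <= tree_size x ->
  consistent x /\ exists2 a, a \in lower x & tree_le y a.
Proof.
move=> x; have [k] := ubnP (tree_size y); elim: k y => // k IH y ltk yx.
move/tree_leE: (yx) => [[u [v []]]//|//|//|[cy [b b_y bx]]] _ szy.
have szb := tree_size_upper b_y.
have bx' : b <> x by move=> bE; move: szb; rewrite bE; lia.
(* Here [y <= x] passes through [b] in [upper y]. As [b] is smaller than [y], it differs from [x],
   and induction puts some [a] of [lower x] above [b]. *)
have [cx [a ax ba]] := IH b (leq_trans szb ltk) bx bx' (ltnW (leq_trans szb szy)).
by split => //; exists a => //; case: cy => c1 c2; exact: (TreeLeUpper b_y c1 c2).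
Qed.

Lemma tree_le_Node_upper n s y : let x := Node n s in
  tree_le x y -> y <> x -> tree_size y <= tree_size x ->
  consistent x /\ exists2 b, b \in upper x & tree_le b y.
Proof.
move=> x; have [k] := ubnP (tree_size y); elim: k y => // k IH y ltk xy.
move/tree_leE: (xy) => [[u [v []]]//|->//|[cy [a ay xa]]|//] _ szy.
have sza := tree_size_lower ay.
have ax' : a <> x by move=> aE; move: sza; rewrite aE; lia.
have [cx [b bx ba]] := IH a (leq_trans sza ltk) xa ax' (ltnW (leq_trans sza szy)).
by split => //; exists b => //; case: cy => c1 c2; exact: (TreeLeLower ay c1 c2).
Qed.

(** Let [x] be a node at least as large as [y] and different from it. Then [b <= y <= a] for some
    [a] in [lower x] and [b] in [upper x], while [a <= b] by consistency; induction gives [a = b],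
    against disjointness. *)
Lemma tree_le_anti x y : tree_le x y -> tree_le y x -> x = y.
Proof.
have [n] := ubnP (maxn (tree_size x) (tree_size y)); elim: n x y => // n IH.
suff main x y : tree_size x < n.+1 -> tree_size y <= tree_size x ->
    tree_le x y -> tree_le y x -> x = y.
  move=> x y sz xy yx; case: (leqP (tree_size y) (tree_size x)) => h.
    by apply: main => //; lia.
  by apply/esym; apply: main => //; lia.
case: x => [u|k s] szx szy xy yx.
  case: y szy xy yx => // v _.
  case/tree_leE => [[u1 [v1 [[->] [->] R1]]]|//|[_ [a]]//|[_ [a]]//].
  case/tree_leE => [[u2 [v2 [e1 e2 R2]]]|//|[_ [a]]//|[_ [a]]//].
  move: e1 e2 R2 => [<-] [<-] R2.
  by congr Leaf; case: Rorder => _ anti _; exact: anti.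
apply: contrapT => neq.
have neq' : y <> Node k s by move=> e; apply: neq.
have [cx [a ax ya]] := tree_le_Node_lower yx neq' szy.
have [_ [b bx le_by]] := tree_le_Node_upper xy neq' szy.
have sz := tree_size_lower_upper ax bx.
suff ab : a = b by have := cx.2 _ ax; rewrite ab bx.
apply: IH; [lia|exact: cx.1|exact: tree_le_trans ya].
Qed.

Lemma tree_partial_order : partial_order tree_le.
Proof. by split; [exact: TreeLeRefl|exact: tree_le_anti|exact: tree_le_trans]. Qed.

Lemma tree_one_point_extension : one_point_extension tree_le.
Proof.
move=> s lo hi lohi loP hiP.
(* The total size of [s] as label makes [z] larger than every member of [s], so any comparison
   between them goes through [lower z] or [upper z]. *)
pose z := Node (sumn (map tree_size s)) [:: Node 0 (filter lo s); Node 0 (filter hi s)].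
have inlo a : (a \in lower z) = lo a && (a \in s) by rewrite mem_filter.
have inhi a : (a \in upper z) = hi a && (a \in s) by rewrite mem_filter.
have cz : consistent z.
  split=> a.
    by move=> b; rewrite inlo inhi => /andP[la sa] /andP[hb sb]; case: (lohi a b).
  rewrite inlo inhi => /andP[la sa]; apply/negP => /andP[ha _].
  by case: (lohi a a).
exists z => c cs.
have szc : tree_size c < tree_size z.
  by have /= := mem_sumn_map cs; lia.
have cz' : c <> z by move=> cE; move: szc; rewrite cE; lia.
split; split => h.
- have [_ [a]] := tree_le_Node_lower h cz' (ltnW szc).
  rewrite inlo => /andP [la sa] ca; exact: (loP a).
- by apply: (TreeLeLower _ cz.1 cz.2 (TreeLeRefl c)); rewrite inlo h.
- have [_ [b]] := tree_le_Node_upper h cz' (ltnW szc).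
  rewrite inhi => /andP [hb sb] bc; exact: (hiP b).
- by apply: (TreeLeUpper _ cz.1 cz.2 (TreeLeRefl c)); rewrite inhi h.
Qed.

End Order.

(** * Functoriality of the free extension and the automorphism swapping pairs *)

Fixpoint tree_map (g : U -> U) (f : nat -> nat) (t : tree) : tree :=
  match t with
  | Leaf u => Leaf (g u)
  | Node n s => Node (f n) (map (tree_map g f) s)
  end.

Lemma tree_map_cancel g g' f f' : cancel g g' -> cancel f f' ->
  cancel (tree_map g f) (tree_map g' f').
Proof.
move=> gK fK t; have [n] := ubnP (tree_size t); elim: n t => // n IH [u|m s] /= ltn.
  by rewrite gK.
rewrite fK -map_comp; congr Node; apply: map_id_in => t ts /=.
by apply: IH; have := mem_sumn_map ts; lia.
Qed.

(** Serves for a map acting on leaves only against one acting on labels only: an isomorphism induced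
    from the base orders commutes with [tree_flip]. *)
Lemma tree_map_comm g f g' f' : (forall u, g (g' u) = g' (g u)) ->
  (forall n, f (f' n) = f' (f n)) ->
  forall t, tree_map g f (tree_map g' f' t) = tree_map g' f' (tree_map g f t).
Proof.
move=> gC fC t; have [n] := ubnP (tree_size t); elim: n t => // n IH [u|m s] /= ltn.
  by rewrite gC.
rewrite fC -!map_comp; congr Node; apply/eq_in_map => t ts /=.
by apply: IH; have := mem_sumn_map ts; lia.
Qed.

Lemma lower_tree_map g f t : lower (tree_map g f t) = map (tree_map g f) (lower t).
Proof. by case: t => [//|n [//|[u|m A] [//|[v|k B] [|w r]]]]. Qed.

Lemma upper_tree_map g f t : upper (tree_map g f t) = map (tree_map g f) (upper t).
Proof. by case: t => [//|n [//|[u|m A] [//|[v|k B] [|w r]]]]. Qed.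

(** Injectivity keeps [lower] and [upper] disjoint, so consistency is preserved along with the
    order. *)
Lemma tree_map_homo (R R' : U -> U -> Prop) g f : injective (tree_map g f) ->
  (forall u v, R u v -> R' (g u) (g v)) ->
  forall x y, tree_le R x y -> tree_le R' (tree_map g f x) (tree_map g f y).
Proof.
move=> inj gR x y; have [n] := ubnP (tree_size x + tree_size y).
elim: n x y => // n IH x y szn.
have mc z : tree_size z <= tree_size x + tree_size y ->
    consistent R z -> consistent R' (tree_map g f z).
  move=> szz [c1 c2]; split.
    move=> a b; rewrite lower_tree_map upper_tree_map => /mapP[a' az ->] /mapP[b' bz ->].
    by apply: IH; [have := tree_size_lower_upper az bz; lia|exact: c1].
  move=> a; rewrite lower_tree_map upper_tree_map => /mapP[a' az ->].
  by rewrite mem_map //; exact: c2.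
case/tree_leE => [[u [v [-> -> Ruv]]]|->|[cy [a ay xa]]|[cx [b bx le_by]]].
- by apply: TreeLeLeaf; exact: gR.
- exact: TreeLeRefl.
- have [c1 c2] := mc _ (leq_addl _ _) cy.
  apply: (@TreeLeLower R' _ _ (tree_map g f a) _ c1 c2).
    by rewrite lower_tree_map map_f.
  by apply: IH => //; have := tree_size_lower ay; lia.
- have [c1 c2] := mc _ (leq_addr _ _) cx.
  apply: (@TreeLeUpper R' _ _ (tree_map g f b) _ c1 c2).
    by rewrite upper_tree_map map_f.
  by apply: IH => //; have := tree_size_upper bx; lia.
Qed.

Lemma tree_map_iso (R R' : U -> U -> Prop) g f : order_iso R R' g -> bijective f ->
  order_iso (tree_le R) (tree_le R') (tree_map g f).
Proof.
move=> [[g' gK g'K] gR] [f' fK f'K].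
have K := tree_map_cancel gK fK; have K' := tree_map_cancel g'K f'K.
split; first by exists (tree_map g' f').
move=> x y; split; first by apply: tree_map_homo; [exact: can_inj K|move=> u v /gR].
rewrite -{2}(K x) -{2}(K y); apply: tree_map_homo; first exact: can_inj K'.
by move=> u v; rewrite gR !g'K.
Qed.

(** The swap of [2k] and [2k+1]: it has no fixed point, so the induced map moves every [Node]. *)
Definition flip_label (n : nat) : nat := if odd n then n.-1 else n.+1.

Lemma flip_labelK : involutive flip_label.
Proof.
by move=> n; rewrite /flip_label; case: (ifP (odd n)) => h1; case: ifP => h2; lia.
Qed.

Definition tree_flip : tree -> tree := tree_map id flip_label.

Lemma tree_flip_iso R : order_iso (tree_le R) (tree_le R) tree_flip.
Proof.
apply: tree_map_iso; last by exists flip_label; exact: flip_labelK.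
by split => //; exists id.
Qed.

Lemma tree_flip_fixed t : tree_flip t = t <-> exists u, t = Leaf u.
Proof.
case: t => [u|n s]; first by split => // _; exists u.
by split => [[] |[]//]; rewrite /flip_label; case: ifP; lia.
Qed.

Lemma tree_le_Leaf R u v : partial_order R -> tree_le R (Leaf u) (Leaf v) <-> R u v.
Proof.
move=> [Rrefl _ _]; split; last exact: TreeLeLeaf.
by case/tree_leE => [[u' [v' [[->] [->]]]]|[->]|[_ []]|[_ []]].
Qed.

Lemma tree_le_trace_meas (X : Type) (sX : set (set X)) (D : set X)
    (R : X -> U -> U -> Prop) :
  sigma_algebra setT sX -> sX D ->
  (forall u v, trace_meas sX D (fun x => R x u v)) ->
  forall s t, trace_meas sX D (fun x => tree_le (R x) s t).
Proof.
move=> sig sD mR s t; have [n] := ubnP (tree_size s + tree_size t).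
elim: n s t => // n IH s t szn.
have mC z : tree_size z <= tree_size s + tree_size t ->
    trace_meas sX D (fun x => consistent (R x) z).
  move=> szz; apply: trace_meas_and => //; last exact: trace_meas_const.
  apply: trace_meas_all => // a; apply: trace_meas_all => // b.
  (* The induction hypothesis covers only members of the two lists; for all other pairs the
     condition is vacuous, hence measurable. *)
  case: (boolP (a \in lower z)) => az; last first.
    by apply: (trace_meas_ext _ (trace_meas_const sig sD True)).
  case: (boolP (b \in upper z)) => bz; last first.
    by apply: (trace_meas_ext _ (trace_meas_const sig sD True)).
  apply: (trace_meas_ext _ (IH a b _)); first by move=> x _; split => // h; exact: h.
  by have := tree_size_lower_upper az bz; lia.
pose Q x := (exists u v, [/\ s = Leaf u, t = Leaf v & R x u v]) \/ (s = t \/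
  ((consistent (R x) t /\ exists a, a \in lower t /\ tree_le (R x) s a) \/
  (consistent (R x) s /\ exists b, b \in upper s /\ tree_le (R x) b t))).
apply: (@trace_meas_ext _ _ _ Q).
  move=> x _; rewrite tree_leE /Q; split.
    case=> [h|[h|[[c [a [h1 h2]]]|[c [a [h1 h2]]]]]]; [by constructor 1|by constructor 2| |].
      by constructor 3; split => //; exists a.
    by constructor 4; split => //; exists a.
  case=> [h|h|[c [a h1 h2]]|[c [a h1 h2]]]; [by left|by right; left|right;right;left|right;right;right].
    by split => //; exists a.
  by split => //; exists a.
apply: trace_meas_or => //; last apply: trace_meas_or => //; last apply: trace_meas_or => //.
- apply: trace_meas_ex => // u; apply: trace_meas_ex => // v.
  apply: (@trace_meas_ext _ _ _ (fun x => (s = Leaf u /\ t = Leaf v) /\ R x u v)).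
    by move=> x _; split => [[[]]|[]].
  by apply: trace_meas_and => //; exact: trace_meas_const.
- exact: trace_meas_const.
- apply: trace_meas_and => //; first by apply: mC; exact: leq_addl.
  apply: trace_meas_ex => // a; case: (boolP (a \in lower t)) => h; last first.
    by apply: (trace_meas_ext _ (trace_meas_const sig sD False)) => x _; split => // -[].
  apply: trace_meas_and => //; first exact: trace_meas_const.
  by apply: IH; have := tree_size_lower h; lia.
- apply: trace_meas_and => //; first by apply: mC; exact: leq_addr.
  apply: trace_meas_ex => // a; case: (boolP (a \in upper s)) => h; last first.
    by apply: (trace_meas_ext _ (trace_meas_const sig sD False)) => x _; split => // -[].
  apply: trace_meas_and => //; first exact: trace_meas_const.
  by apply: IH; have := tree_size_upper h; lia.
Qed.

End FreeExtension.

(** * Measurable back-and-forth *)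

Lemma generic_partial_order (P : relspace) :
  generic_porder P -> partial_order (fun a b => P a b).
Proof. by case=> -[Pr [Pa Pt]] _; split => // y x z; exact: Pt. Qed.

(* Universality realizes the abstract extension of [s] somewhere in [P], and an
   automorphism given by homogeneity moves it over [s]. *)
Lemma generic_one_point_extension (P : relspace) :
  generic_porder P -> one_point_extension (fun a b => P a b).
Proof.
move=> [[Prefl [Panti Ptrans]] [Phom Puniv]] s lo hi lohi loP hiP.
set t := undup s; set n := size t.
have tnth_s i : i < n -> nth 0 t i \in s by move=> lt; rewrite -(mem_undup s) mem_nth.
(* Indices below [n] copy [s] without repetitions, and the index [n] is the new point. *)
pose r (i j : 'I_n.+1) : bool :=
  if i < n then (if j < n then P (nth 0 t i) (nth 0 t j) else lo (nth 0 t i))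
  else (if j < n then hi (nth 0 t j) else true).
have rP : is_fin_porder r.
  split; first by move=> x; rewrite /r; case: (x < n).
  split.
    move=> x y; rewrite /r; case: (ltnP x n) => xn; case: (ltnP y n) => yn.
    - move=> xy yx; apply/val_inj/eqP.
      by rewrite /= -(nth_uniq 0 xn yn (undup_uniq s)); apply/eqP; exact: Panti.
    - by move=> l h; case: (lohi _ _ (tnth_s _ xn) (tnth_s _ xn) l h).
    - by move=> h l; case: (lohi _ _ (tnth_s _ yn) (tnth_s _ yn) l h).
    - by move=> _ _; apply: val_inj => /=; have := ltn_ord x; have := ltn_ord y; lia.
  move=> x y z; rewrite /r; case: (ltnP x n) => xn; case: (ltnP y n) => yn;
    case: (ltnP z n) => zn // h1 h2.
  - exact: Ptrans h2.
  - by apply: (loP _ _ (tnth_s _ yn)) => //; exact: tnth_s.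
  - by case: (lohi _ _ (tnth_s _ xn) (tnth_s _ zn) h1 h2).
  - by apply: (hiP _ _ (tnth_s _ yn)) => //; exact: tnth_s.
have [e [einj eP]] := Puniv _ r rP.
(* Moves the copy of [s] back onto [s]. Homogeneity is applied on [s'], which omits the new point,
   so the default values 0 are harmless. *)
pose h m := if [pick i | e i == m] is Some i then nth 0 t i else 0.
have hE i : h (e i) = nth 0 t i.
  by rewrite /h; case: pickP => [j /eqP /einj ->//|/(_ i)]; rewrite eqxx.
pose s' := [seq e (inord i) | i <- iota 0 n].
have s'P m : m \in s' -> exists i : 'I_n.+1, i < n /\ m = e i.
  case/mapP=> i; rewrite mem_iota add0n => /andP[_ lt] ->; exists (inord i).
  by rewrite inordK // ltnW.
have [||alpha [[abij aP] ah]] := Phom s' h.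
- move=> _ _ /s'P [i [lti ->]] /s'P [j [ltj ->]]; rewrite !hE => /eqP.
  by rewrite nth_uniq // ?undup_uniq // => /eqP ij; congr e; exact: val_inj.
- move=> _ _ /s'P [i [lti ->]] /s'P [j [ltj ->]]; rewrite !hE -eP /r.
  by rewrite lti ltj.
exists (alpha (e ord_max)) => c cs.
have lt : index c t < n by rewrite index_mem mem_undup.
pose k : 'I_n.+1 := inord (index c t).
have kE : k = index c t :> nat by rewrite inordK // ltnW.
have ct : alpha (e k) = c.
  rewrite ah; first by rewrite hE kE nth_index // mem_undup.
  by apply: (map_f (fun i => e (inord i))); rewrite mem_iota add0n lt.
have tk : nth 0 t k = c by rewrite kE nth_index // mem_undup.
have -> : P c (alpha (e ord_max)) = lo c.
  by rewrite -{1}ct -aP -eP /r tk kE lt ltnn.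
have -> : P (alpha (e ord_max)) c = hi c.
  by rewrite -{1}ct -aP -eP /r tk kE lt ltnn.
by [].
Qed.

Section BackAndForth.
Variables (T S : countType).

(** Single-valuedness and injectivity are not imposed: for partial orders both follow by reflexivity
    and antisymmetry. *)
Definition partial_iso (leT : T -> T -> Prop) (leS : S -> S -> Prop) (p : seq (T * S)) :=
  {in p &, forall a b, leT a.1 b.1 <-> leS a.2 b.2}.

Lemma partial_iso_forth (leT : T -> T -> Prop) (leS : S -> S -> Prop) p t :
  partial_order leT -> partial_order leS -> one_point_extension leS ->
  partial_iso leT leS p -> exists z, partial_iso leT leS ((t, z) :: p).
Proof.
move=> [Tr Ta Tt] [Sr Sa St] ext pP.
have [[z tz]|tp] := pselect (exists z, (t, z) \in p).
  exists z => a b; rewrite !in_cons => /orP aP /orP bP.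
  by apply: pP; [case: aP => [/eqP ->|]|case: bP => [/eqP ->|]].
have p2P a b : a \in p -> b \in p -> a.2 = b.2 -> a.1 = b.1.
  by move=> ap bp ab; apply: Ta; apply/pP => //; rewrite ab; exact: Sr.
(* The type of [t] over the domain of [p], transported to the range. *)
pose lo z := has (fun a => (a.2 == z) && `[< leT a.1 t >]) p.
pose hi z := has (fun a => (a.2 == z) && `[< leT t a.1 >]) p.
have loE a : a \in p -> lo a.2 <-> leT a.1 t.
  move=> ap; split => [/hasP[b bp /andP[/eqP ba /asboolP]]|h].
    by rewrite (p2P b a).
  by apply/hasP; exists a => //; rewrite eqxx; exact/asboolP.
have hiE a : a \in p -> hi a.2 <-> leT t a.1.
  move=> ap; split => [/hasP[b bp /andP[/eqP ba /asboolP]]|h].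
    by rewrite (p2P b a).
  by apply/hasP; exists a => //; rewrite eqxx; exact/asboolP.
have [|||z zP] := ext [seq a.2 | a <- p] lo hi.
- move=> _ _ /mapP[a ap ->] /mapP[b bp ->] /(loE a ap) at_ /(hiE b bp) tb.
  split; first by apply/pP => //; exact: Tt tb.
  (* Equal images would squeeze [t] between [a.1] and itself, placing [t] in the domain of [p]. *)
  move/(p2P a b ap bp) => ab; apply: tp; exists a.2.
  suff -> : t = a.1 by rewrite -surjective_pairing.
  by apply: Ta => //; rewrite ab.
- move=> _ _ /mapP[a ap ->] /mapP[b bp ->] /(loE a ap) at_ /(pP b a bp ap) ba.
  by apply/loE => //; exact: Tt at_.
- move=> _ _ /mapP[a ap ->] /mapP[b bp ->] /(hiE a ap) at_ /(pP a b ap bp) ba.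
  by apply/hiE => //; exact: Tt ba.
exists z => a b; rewrite !in_cons => /orP[/eqP ->|ap] /orP[/eqP ->|bp] /=.
- by split.
- by have [_ ->] := zP _ (map_f snd bp); rewrite hiE.
- by have [-> _] := zP _ (map_f snd ap); rewrite loE.
- exact: pP.
Qed.

End BackAndForth.

Lemma partial_iso_sym (T S : countType) (leT : T -> T -> Prop) (leS : S -> S -> Prop) p :
  partial_iso leT leS p -> partial_iso leS leT [seq (a.2, a.1) | a <- p].
Proof. by move=> pP _ _ /mapP[a ap ->] /mapP[b bp ->] /=; split => /(pP a b ap bp). Qed.

Lemma partial_iso_back (T S : countType) (leT : T -> T -> Prop) (leS : S -> S -> Prop) p z :
  partial_order leT -> partial_order leS -> one_point_extension leT ->
  partial_iso leT leS p -> exists t, partial_iso leT leS ((t, z) :: p).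
Proof.
move=> Tord Sord ext pP.
have [t tP] := partial_iso_forth z Sord Tord ext (partial_iso_sym pP); exists t.
by move: (partial_iso_sym tP); rewrite /= -map_comp map_id_in // => -[].
Qed.

Section MeasurableBackAndForth.
Variables (X : Type) (sX : set (set X)) (D : set X).
Hypotheses (sigmaX : sigma_algebra setT sX) (sD : sX D).
Variables (T S : countType) (z0 : S) (leT : X -> T -> T -> Prop) (leS : S -> S -> Prop).
Hypotheses (leT_meas : forall s t, trace_meas sX D (fun x => leT x s t)).
Hypotheses (leT_order : forall x, D x -> partial_order (leT x))
  (leT_ext : forall x, D x -> one_point_extension (leT x)).
Hypotheses (leS_order : partial_order leS) (leS_ext : one_point_extension leS).

(** Enumerating the disjoint union schedules both directions at once: [inl] asks for a forth step,
    [inr] for a back step. *)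
Definition stage_goal (k : nat) (p : seq (T * S)) : Prop :=
  match @unpickle (T + S)%type k with
  | Some (inl t) => exists z, (t, z) \in p
  | Some (inr z) => exists t, (t, z) \in p
  | None => True
  end.

(** Each stage is a finite list picked by [measurable_selection]. As there are only countably many
    lists, measurability passes from stage to stage by splitting over the previous value, and then
    to the union [H] of all stages. *)
Lemma measurable_iso : exists h : X -> T -> S,
  (forall t z, trace_meas sX D (fun x => h x t = z)) /\
  (forall x, D x -> order_iso (leT x) leS (h x)).
Proof.
pose W k (p : seq (T * S)) x q := [/\ partial_iso (leT x) leS q, {subset p <= q} & stage_goal k q].
have Wmeas k p q : trace_meas sX D (fun x => W k p x q).
  apply: (@trace_meas_ext _ _ _
    (fun x => partial_iso (leT x) leS q /\ ({subset p <= q} /\ stage_goal k q))).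
    by move=> x _; split => [[? []]|[]].
  apply: trace_meas_and => //; last exact: trace_meas_const.
  do 2 (apply: trace_meas_all => // ?).
  do 2 (apply: trace_meas_imp => //; first exact: trace_meas_const).
  by apply: trace_meas_iff => //; exact: trace_meas_const.
have Wex k p x : D x -> partial_iso (leT x) leS p -> exists q, W k p x q.
  move=> Dx pP; rewrite /W /stage_goal; case: (unpickle k) => [[t|z]|]; last by exists p; split.
    have [z zP] := partial_iso_forth t (leT_order Dx) leS_order leS_ext pP.
    exists ((t, z) :: p); split => //; first by move=> a ap; rewrite in_cons ap orbT.
    by exists z; rewrite mem_head.
  have [t tP] := partial_iso_back z (leT_order Dx) leS_order (leT_ext Dx) pP.
  exists ((t, z) :: p); split => //; first by move=> a ap; rewrite in_cons ap orbT.
  by exists t; rewrite mem_head.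
have [c cP] := choice (fun kp : nat * seq (T * S) =>
  measurable_selection sigmaX sD [::] (Wmeas kp.1 kp.2)).
pose fix state x k := if k is k'.+1 then c (k', state x k') x else [::].
have state_meas k : forall p, trace_meas sX D (fun x => state x k = p).
  elim: k => [|k IH] p; first exact: (trace_meas_const sigmaX sD ([::] = p)).
  apply: (@trace_meas_ext _ _ _ (fun x => exists q, state x k = q /\ c (k, q) x = p)).
    by move=> x _; split => [[q [<-]]|] //= h; exists (state x k).
  apply: trace_meas_ex => // q; apply: trace_meas_and => //.
  exact: (cP (k, q)).1.
pose H x t z := exists k, (t, z) \in state x k.
have H_meas t z : trace_meas sX D (fun x => H x t z).
  apply: trace_meas_ex => // k.
  apply: (@trace_meas_ext _ _ _ (fun x => exists q, state x k = q /\ (t, z) \in q)).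
    by move=> x _; split => [[q [<-]]|] //= h; exists (state x k).
  by apply: trace_meas_ex => // q; apply: trace_meas_and => //; exact: trace_meas_const.
have stateP x k : D x -> partial_iso (leT x) leS (state x k).
  move=> Dx; elim: k => [//|k IH] /=.
  by case: ((cP (k, state x k)).2 x (Wex k _ x Dx IH)).
have stateS x k : D x -> W k (state x k) x (state x k.+1).
  by move=> Dx; exact: (cP (k, state x k)).2 x (Wex k _ x Dx (stateP x k Dx)).
have state_mono x k l : D x -> k <= l -> {subset state x k <= state x l}.
  move=> Dx; elim: l => [|l IH]; first by rewrite leqn0 => /eqP ->.
  rewrite leq_eqVlt => /orP[/eqP -> //|/IH h] a /h.
  by case: (stateS x l Dx) => _ sub _; exact: sub.
have HP x s t y z : D x -> H x s y -> H x t z -> (leT x s t <-> leS y z).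
  move=> Dx [k sk] [l tl].
  have sm := state_mono x k (maxn k l) Dx (leq_maxl _ _) _ sk.
  have tm := state_mono x l (maxn k l) Dx (leq_maxr _ _) _ tl.
  exact: (stateP x (maxn k l) Dx _ _ sm tm).
have Htot x t : D x -> exists z, H x t z.
  move=> Dx; case: (stateS x (pickle (inl t : T + S)) Dx) => _ _.
  by rewrite /stage_goal pickleK => -[z zP]; exists z, (pickle (inl t : T + S)).+1.
have Hsurj x z : D x -> exists t, H x t z.
  move=> Dx; case: (stateS x (pickle (inr z : T + S)) Dx) => _ _.
  by rewrite /stage_goal pickleK => -[t tP]; exists t, (pickle (inr z : T + S)).+1.
have Hfun x t y z : D x -> H x t y -> H x t z -> y = z.
  move=> Dx ty tz; have [Sr Sa _] := leS_order; have [Tr _ _] := leT_order Dx.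
  by apply: Sa; [apply/(HP x t t)|apply/(HP x t t)].
have Hinj x s t z : D x -> H x s z -> H x t z -> s = t.
  move=> Dx sz tz; have [Sr _ _] := leS_order; have [_ Ta _] := leT_order Dx.
  by apply: Ta; [apply/(HP x s t z z)|apply/(HP x t s z z)].
(* The default [z0] can occur only off [D]. *)
pose h x t := xget z0 [set z | H x t z].
have hP x t : D x -> H x t (h x t).
  by move=> Dx; have [z zP] := Htot x t Dx; exact: (xgetPex z0 (ex_intro _ z zP)).
exists h; split.
  move=> t z; apply: (@trace_meas_ext _ _ _ (fun x => H x t z)) => // x Dx.
  by split => [tz|<-]; [apply: (Hfun x t) => //; exact: hP|exact: hP].
move=> x Dx; split; last by move=> s t; apply: HP => //; exact: hP.
have [g gP] := choice (fun z => Hsurj x z Dx).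
exists g => [t|z].
  by apply: (Hinj x _ _ (h x t)) => //; exact: hP.
by apply: (Hfun x (g z)) => //; exact: hP.
Qed.

End MeasurableBackAndForth.

(** * From partial orders to automorphisms *)

Lemma order_iso_comp (T1 T2 T3 : Type) (le1 : T1 -> T1 -> Prop)
    (le2 : T2 -> T2 -> Prop) (le3 : T3 -> T3 -> Prop) g h :
  order_iso le2 le3 g -> order_iso le1 le2 h -> order_iso le1 le3 (g \o h).
Proof.
move=> [gB gP] [hB hP]; split; first exact: bij_comp.
by move=> x y; rewrite hP gP.
Qed.

Lemma order_iso_inv (T1 T2 : Type) (le1 : T1 -> T1 -> Prop) (le2 : T2 -> T2 -> Prop)
    g : order_iso le1 le2 g ->
  exists g', [/\ cancel g g', cancel g' g & order_iso le2 le1 g'].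
Proof.
move=> [[g' gK g'K] gP]; exists g'; split => //; split; first by exists g.
by move=> x y; rewrite gP !g'K.
Qed.

Lemma is_autP (P : relspace) (a : baire) :
  is_aut P a <-> order_iso (fun m n => P m n) (fun m n => P m n) a.
Proof.
split=> -[aB aP]; split => // m n; first by rewrite -aP.
by apply/idP/idP; case: (aP m n).
Qed.

(** A map commuting with the flips preserves their fixed points, which are the leaves, and the
    leaves carry copies of [R] and [R']. *)
Lemma tree_flip_equivariant_iso (U : countType) (R R' : U -> U -> Prop)
    (theta : GenTree.tree U -> GenTree.tree U) :
  partial_order R -> partial_order R' ->
  order_iso (tree_le R) (tree_le R') theta ->
  (forall t, theta (tree_flip t) = tree_flip (theta t)) ->
  exists g, order_iso R R' g.
Proof.
move=> oR oR' thetaI thetaC.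
have [theta' [K K' _]] := order_iso_inv thetaI.
have thetaC' t : theta' (tree_flip t) = tree_flip (theta' t).
  by apply: (can_inj K); rewrite K' thetaC K'.
have leafE (t : GenTree.tree U) : (exists u, t = GenTree.Leaf u) ->
    forall f : GenTree.tree U -> GenTree.tree U,
    f (tree_flip t) = tree_flip (f t) -> exists u, f t = GenTree.Leaf u.
  by move=> /tree_flip_fixed tF f fC; apply/tree_flip_fixed; rewrite -fC tF.
have [g gP] := choice (fun u =>
  leafE (GenTree.Leaf u) (ex_intro _ u erefl) theta (thetaC _)).
have [g' g'P] := choice (fun u =>
  leafE (GenTree.Leaf u) (ex_intro _ u erefl) theta' (thetaC' _)).
exists g; split.
  exists g' => u.
    by have := K (GenTree.Leaf u); rewrite gP g'P => -[].
  by have := K' (GenTree.Leaf u); rewrite g'P gP => -[].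
by move=> u v; rewrite -(tree_le_Leaf u v oR) thetaI.2 !gP tree_le_Leaf.
Qed.

(** Stated for a measurable family of orders on any countable set, so that it applies both to orders
    on the naturals and to codes of structures. *)
Lemma porder_family_reducible (P : relspace) (X : Type) (sX : set (set X)) (D : set X)
    (U : countType) (R : X -> U -> U -> Prop) (E : X -> X -> Prop) :
  generic_porder P -> sigma_algebra setT sX -> sX D ->
  (forall u v, trace_meas sX D (fun x => R x u v)) ->
  (forall x, D x -> partial_order (R x)) ->
  (forall x x', D x -> D x' -> (E x x' <-> exists g, order_iso (R x) (R x') g)) ->
  borel_reducible sX D E baire_borel (is_aut P) (aut_conj P).
Proof.
move=> HP sigX sD Rmeas Rord RE.
have [h [hmeas hiso]] := measurable_iso sigX sD 0
  (tree_le_trace_meas sigX sD Rmeas) (fun x Dx => tree_partial_order (Rord x Dx))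
  (fun x _ => @tree_one_point_extension _ (R x))
  (generic_partial_order HP) (generic_one_point_extension HP).
have fex x : exists f : baire, D x ->
    is_aut P f /\ forall t, f (h x t) = h x (tree_flip t).
  have [Dx|nD] := pselect (D x); last by exists id => /nD.
  have [h' [K K' h'iso]] := order_iso_inv (hiso x Dx).
  exists (h x \o (@tree_flip U \o h')) => _; split; last by move=> t /=; rewrite K.
  apply/is_autP; apply: order_iso_comp (hiso x Dx) _.
  by apply: order_iso_comp h'iso; exact: tree_flip_iso.
have [f fP] := choice fex.
exists f; split; first by move=> x /fP [].
split.
  apply: trace_meas_preimage => // _ [n [m ->]].
  (* Quantifying over the tree [t] named by [n] avoids the inverse of [h x], whose measurability
     would need a separate argument. *)
  apply: (@trace_meas_ext _ _ _
      (fun x => exists t, h x t = n /\ h x (tree_flip t) = m)).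
    move=> x Dx; have [h' [K K' _]] := order_iso_inv (hiso x Dx).
    have [_ fh] := fP x Dx; split => [[t [<- <-]]|/= <-]; first exact: fh.
    by exists (h' n); rewrite -fh K'.
  by apply: trace_meas_ex => // t; apply: trace_meas_and.
move=> x y Dx Dy; rewrite RE //.
have [hx' [Kx Kx' hx'iso]] := order_iso_inv (hiso x Dx).
have [hy' [Ky Ky' hy'iso]] := order_iso_inv (hiso y Dy).
have [_ fx] := fP x Dx; have [_ fy] := fP y Dy.
split=> [[g giso]|[alpha [/is_autP aiso aC]]].
  exists (h y \o (tree_map g id \o hx')); split.
    apply/is_autP; apply: order_iso_comp (hiso y Dy) _; apply: order_iso_comp hx'iso.
    by apply: tree_map_iso => //; exists id.
  move=> n; rewrite -(Kx' n) fx /= !Kx fy; congr (h y _).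
  exact: tree_map_comm.
apply: (@tree_flip_equivariant_iso _ _ _ (hy' \o (alpha \o h x))); [exact: Rord|exact: Rord| |].
  by apply: order_iso_comp hy'iso _; apply: order_iso_comp aiso (hiso x Dx).
by move=> t /=; apply: (can_inj Ky); rewrite Ky' -fy Ky' -aC fx.
Qed.

(** * Borel sets of codes, and automorphisms as countable structures *)

Lemma rel_borel_cylinder (m n : nat) : rel_borel [set r : relspace | r m n].
Proof. by apply: sub_sigma_algebra; exists m, n, true. Qed.

Lemma is_porder_borel : rel_borel is_porder.
Proof.
have sig : sigma_algebra setT rel_borel by exact: smallest_sigma_algebra.
have sT : rel_borel setT by case: sig => s0 sC _; rewrite -(setD0 setT); exact: sC.
have mr m n : trace_meas rel_borel setT (fun r : relspace => r m n).
  by rewrite /trace_meas setTI; exact: rel_borel_cylinder.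
suff : trace_meas rel_borel setT is_porder by rewrite /trace_meas setTI.
rewrite /is_porder.
apply: (trace_meas_and sig sT); first by apply: (trace_meas_all sig sT) => m.
apply: (trace_meas_and sig sT).
  do 2 (apply: (trace_meas_all sig sT) => ?).
  by do 2 (apply: (trace_meas_imp sig sT) => //); exact: (trace_meas_const sig sT).
do 3 (apply: (trace_meas_all sig sT) => ?).
by do 2 (apply: (trace_meas_imp sig sT) => //).
Qed.

Lemma porder_reducible_aut (P : relspace) : generic_porder P ->
  borel_reducible rel_borel is_porder porder_iso baire_borel (is_aut P) (aut_conj P).
Proof.
move=> HP; apply: (@porder_family_reducible P _ _ _ nat (fun (r : relspace) m n => r m n)) => //.
- exact: smallest_sigma_algebra.
- exact: is_porder_borel.
- move=> m n; have sig : sigma_algebra setT rel_borel by exact: smallest_sigma_algebra.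
  exact: (sigma_algebra_setI sig is_porder_borel (rel_borel_cylinder m n)).
- by move=> r [r1 [r2 r3]]; split => // y x z; exact: r3.
move=> r r' _ _; split => -[g [gB gP]]; exists g; split => // m n; first by rewrite gP.
by apply/idP/idP; case: (gP m n).
Qed.

Lemma is_aut_borel (P : relspace) : baire_borel (is_aut P).
Proof.
have sig : sigma_algebra setT baire_borel by exact: smallest_sigma_algebra.
have sT : baire_borel setT by case: sig => s0 sC _; rewrite -(setD0 setT); exact: sC.
have mf m n : trace_meas baire_borel setT (fun f : baire => f m = n).
  by rewrite /trace_meas setTI; apply: sub_sigma_algebra; exists m, n.
suff : trace_meas baire_borel setT (is_aut P) by rewrite /trace_meas setTI.
(* Naming the values [n] and [n'] writes every clause through the cylinders [f m = n] and countable
   quantifiers. *)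
pose Q (f : baire) := ((forall n, exists m, f m = n) /\
  (forall m m' n, f m = n -> f m' = n -> m = m')) /\
  (forall m m' n n', f m = n -> f m' = n' -> P m m' = P n n').
apply: (@trace_meas_ext _ baire_borel setT Q).
  move=> f _; split.
    move=> [[fs fi] fP]; split; last by move=> m m'; exact: fP.
    have [g gP] := choice fs; exists g => // m.
    by apply: fi => //; rewrite gP.
  move=> [[g K K'] fP]; split; last by move=> m m' n n' <- <-.
  split=> [n|m m' n <- e]; first by exists (g n).
  by apply/esym; apply: (can_inj K).
apply: (trace_meas_and sig sT); first apply: (trace_meas_and sig sT).
- by apply: (trace_meas_all sig sT) => n; apply: (trace_meas_ex sig).
- do 3 (apply: (trace_meas_all sig sT) => ?).
  by do 2 (apply: (trace_meas_imp sig sT) => //); exact: (trace_meas_const sig sT).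
- do 4 (apply: (trace_meas_all sig sT) => ?).
  by do 2 (apply: (trace_meas_imp sig sT) => //); exact: (trace_meas_const sig sT).
Qed.

(** Symbol [true] is interpreted by [P] and [false] by the graph. An isomorphism preserves [P], so
    it is an automorphism, and matching the graphs makes it a conjugacy. *)
Lemma aut_conj_reducible_struct (P : relspace) :
  exists (I : countType) (ar : I -> nat) (C : set (struct_space ar)),
    struct_class C /\
    borel_reducible baire_borel (is_aut P) (aut_conj P)
      (@struct_borel I ar) C (@struct_iso I ar).
Proof.
pose ar (b : bool) := 2; exists bool, ar, setT; split.
  split=> //; have [s0 sC _] := smallest_sigma_algebra setT
    [set A | exists (i : bool) (t : (ar i).-tuple nat) (b : bool),
      A = [set x : struct_space ar | x i t = b]].
  by rewrite -(setD0 setT); exact: sC.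
pose F (f : baire) : struct_space ar := fun b t =>
  if b then P (tnth t ord0) (tnth t ord_max)
  else f (tnth t ord0) == tnth t ord_max.
exists F; split => //; split.
  apply: trace_meas_preimage => //.
  - exact: smallest_sigma_algebra.
  - exact: is_aut_borel.
  move=> _ [i [t [b ->]]].
  have sig : sigma_algebra setT baire_borel by exact: smallest_sigma_algebra.
  case: i t => t; first exact: (trace_meas_const sig (is_aut_borel P)
      (P (tnth t ord0) (tnth t ord_max) = b)).
  apply: (@trace_meas_ext _ baire_borel _ (fun f : baire => f (tnth t ord0) = tnth t ord_max <-> b)).
    move=> f _; rewrite /= /F; split.
      by move=> h; apply/idP/idP => [/eqP /h|/h /eqP].
    by move=> <-; split => /eqP.
  apply: (trace_meas_iff sig (is_aut_borel P)); last first.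
    exact: (trace_meas_const sig (is_aut_borel P)).
  apply: (sigma_algebra_setI sig (is_aut_borel P)).
  by apply: sub_sigma_algebra; exists (tnth t ord0), (tnth t ord_max).
move=> f f' _ _; split.
  move=> [a [[aB aP] aC]]; exists a; split => // -[] t; rewrite /F !tnth_map; first exact: aP.
  by rewrite -aC (inj_eq (bij_inj aB)).
move=> [a [aB aP]]; exists a; split.
  split=> // m n; have := aP true [tuple m; n].
  by rewrite /F !tnth_map !(tnth_nth 0).
move=> m; have := aP false [tuple m; f m].
by rewrite /F !tnth_map !(tnth_nth 0) /= eqxx => /esym /eqP ->.
Qed.

(** * From structures to partial orders *)

Section StructureCode.
Variables (I : countType) (ar : I -> nat).
Local Notation struct := (struct_space ar).

Definition atom := {i : I & (ar i).-tuple nat}.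

(** Slots exist for every [j], even beyond the arity, so a nullary atom also has slots to record its
    truth value. *)
Definition code_point := ((nat + nat) + (atom + atom * nat))%type.
Definition Rung (k : nat) : code_point := inl (inl k).
Definition Elem (n : nat) : code_point := inl (inr n).
Definition Atom (a : atom) : code_point := inr (inl a).
Definition Slot (a : atom) (j : nat) : code_point := inr (inr (a, j)).

(** Off the rungs the colour separates the kinds: 0 for elements, 1 for atoms, at least 2 for slots.
    [Rung k] has colour [k] because [k] rungs precede it. *)
Definition colour (x : struct) (u : code_point) : nat :=
  match u with
  | inl (inl k) => k
  | inl (inr _) => 0
  | inr (inl _) => 1
  | inr (inr (a, j)) => (pickle (tag a, j, x (tag a) (tagged a))).+2
  end.

(* The rungs form a chain of type omega; a point lies above as many rungs as its
   colour says.  [Slot a j] lies above [Atom a] and above the [j]-th entry of [a];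
   its colour records the relation symbol, [j] and the truth value of [a]. *)
Definition code_lt (x : struct) (u v : code_point) : bool :=
  match u, v with
  | inl (inl k), _ => k < colour x v
  | inl (inr n), inr (inr (a, j)) => onth (tagged a) j == Some n
  | inr (inl a), inr (inr (b, j)) => a == b
  | _, _ => false
  end.

Definition code_le (x : struct) (u v : code_point) : Prop := u = v \/ code_lt x u v.

Lemma code_lt_irr x u : code_lt x u u = false.
Proof. by case: u => [[k|n]|[a|[a j]]] //=; rewrite ltnn. Qed.

(** Slots are maximal, so the middle point is not a slot and only rungs lie below it; and the colour
    does not drop from [v] to [w]. *)
Lemma code_lt_trans x v u w : code_lt x u v -> code_lt x v w -> code_lt x u w.
Proof.
case: u v w => [[k|n]|[a|[a j]]] [[k'|n']|[a'|[a' j']]] [[k''|n'']|[a''|[a'' j'']]] //=; lia.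
Qed.

Lemma code_partial_order x : partial_order (code_le x).
Proof.
split=> [u|u v [//|uv] [//|vu]|v u w]; first by left.
  by have := code_lt_trans uv vu; rewrite code_lt_irr.
case=> [->//|uv] [<-|vw]; first by right.
by right; exact: code_lt_trans vw.
Qed.

Lemma code_ltE x u v : code_lt x u v <-> code_le x u v /\ u <> v.
Proof.
split=> [uv|[[//|//]]]; split; first by right.
by move=> e; move: uv; rewrite e code_lt_irr.
Qed.

Lemma code_iso_lt x y G : order_iso (code_le x) (code_le y) G ->
  forall u v, code_lt x u v = code_lt y (G u) (G v).
Proof.
move=> [Gb GP] u v; have Ginj := bij_inj Gb.
apply/idP/idP => /code_ltE [/GP h ne]; apply/code_ltE; split => //.
- by move/Ginj.
- by move=> e; apply: ne; rewrite e.
Qed.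

Lemma code_bij_lt x y G : bijective G ->
  (forall u v, code_lt x u v = code_lt y (G u) (G v)) ->
  order_iso (code_le x) (code_le y) G.
Proof.
move=> Gb GP; split => // u v; have Ginj := bij_inj Gb.
by split=> -[]; [move=> ->; left|rewrite GP; right|move/Ginj ->; left|rewrite -GP; right].
Qed.

Definition atom_map (g : nat -> nat) (a : atom) : atom :=
  Tagged (fun i => (ar i).-tuple nat) (map_tuple g (tagged a)).

Lemma atom_mapK g g' : cancel g g' -> cancel (atom_map g) (atom_map g').
Proof.
move=> gK [i t]; rewrite /atom_map /=; congr Tagged; apply: val_inj => /=.
by rewrite -map_comp map_id_in // => n _ /=; rewrite gK.
Qed.

Definition code_map (g : nat -> nat) (u : code_point) : code_point :=
  match u with
  | inl (inl k) => Rung k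
  | inl (inr n) => Elem (g n)
  | inr (inl a) => Atom (atom_map g a)
  | inr (inr (a, j)) => Slot (atom_map g a) j
  end.

Lemma code_mapK g g' : cancel g g' -> cancel (code_map g) (code_map g').
Proof.
by move=> gK [[k|n]|[a|[a j]]] //=; rewrite ?gK // (atom_mapK gK).
Qed.

Lemma struct_iso_code x y : struct_iso x y ->
  exists G, order_iso (code_le x) (code_le y) G.
Proof.
move=> [g [gB gP]]; have gI := bij_inj gB; exists (code_map g).
have [g' gK g'K] := gB.
have aI := can_inj (atom_mapK gK).
apply: code_bij_lt; first by exists (code_map g'); exact: code_mapK.
have colourE u : colour y (code_map g u) = colour x u.
  by case: u => [[k|n]|[a|[a j]]] //=; rewrite -gP.
case=> [[k|n]|[a|[a j]]] [[k'|n']|[a'|[a' j']]] //=; rewrite ?gP //.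
- rewrite onth_map; case: (onth _ _) => //= m.
  by apply/eqP/eqP => -[]; [move=> ->|move/gI ->].
- by rewrite (inj_eq aI).
Qed.

(** * Recovering a structure from its code *)

Definition is_rung (u : code_point) : bool := if u is inl (inl _) then true else false.

(** Makes the rungs definable from the order: above an element or an atom there are only slots, and
    these are maximal. *)
Lemma is_rungP x u : is_rung u <-> exists v w, code_lt x u v /\ code_lt x v w.
Proof.
split.
  case: u => [[k|//]|//] _; exists (Rung k.+1), (Rung k.+2) => /=; split; exact: ltnSn.
by case=> v [w []]; case: u => [[k|n]|[a|[a j]]] //; case: v => [[k'|n']|[a'|[a' j']]].
Qed.

Section IsoInvariants.
Variables (x y : struct) (G : code_point -> code_point).
Hypothesis Giso : order_iso (code_le x) (code_le y) G.

Lemma is_rung_iso u : is_rung (G u) = is_rung u.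
Proof.
have [G' [K K' _]] := order_iso_inv Giso; have lt := code_iso_lt Giso.
apply/idP/idP => [/(is_rungP y) [v [w [uv vw]]]|/(is_rungP x) [v [w [uv vw]]]].
  by apply/(is_rungP x); exists (G' v), (G' w); rewrite !lt !K'.
by apply/(is_rungP y); exists (G v), (G w); rewrite -!lt.
Qed.

(** Rigidity of a chain of type omega. If all earlier rungs are fixed, [Rung k] cannot go lower by
    injectivity, nor higher, since the preimage of [Rung k] would then be an earlier rung. *)
Lemma rung_iso k : G (Rung k) = Rung k.
Proof.
have [G' [K K' _]] := order_iso_inv Giso; have lt := code_iso_lt Giso.
have GI := can_inj K.
have rE u : is_rung u -> exists m, u = Rung m by case: u => [[m|//]|//]; exists m.
have [n] := ubnP k; elim: n k => // n IH k ltn.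
have [|m Gk] := rE (G (Rung k)); first by rewrite is_rung_iso.
rewrite Gk; case: (ltngtP m k) => [mk|km|->//].
  have /GI [e] := etrans Gk (esym (IH m (leq_trans mk ltn))).
  by move: mk; rewrite e ltnn.
have [|l Gl] := rE (G' (Rung k)); first by rewrite -is_rung_iso K'.
have lk : l < k.
  suff : code_lt x (Rung l) (Rung k) by [].
  by rewrite lt -Gl K' Gk.
have := IH l (leq_trans lk ltn); rewrite -Gl K' Gl => -[e].
by move: lk; rewrite e ltnn.
Qed.

(** The rungs below a point determine its colour, and all rungs are fixed. *)
Lemma colour_iso u : colour y (G u) = colour x u.
Proof.
have h k : (k < colour x u) = (k < colour y (G u)).
  by have := code_iso_lt Giso (Rung k) u; rewrite rung_iso.
case: (ltngtP (colour y (G u)) (colour x u)) => //.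
  by rewrite h ltnn.
by rewrite -h ltnn.
Qed.

Lemma Elem_iso n : exists m, G (Elem n) = Elem m.
Proof.
have := colour_iso (Elem n); have := is_rung_iso (Elem n).
by case: (G (Elem n)) => [[k|m]|[a|[a j]]] //; exists m.
Qed.

(** A slot lies above a single atom, and by injectivity of [pickle] its colour returns the symbol,
    the position and the truth value. *)
Lemma Atom_iso a : exists b, [/\ tag b = tag a, G (Atom a) = Atom b,
  forall j, G (Slot a j) = Slot b j & @y _ (tagged b) = @x _ (tagged a)].
Proof.
have [b Gb] : exists b, G (Atom a) = Atom b.
  have := colour_iso (Atom a); have := is_rung_iso (Atom a).
  by case: (G (Atom a)) => [[k|m]|[b|[b j]]] //; exists b.
have slot j : [/\ tag b = tag a, G (Slot a j) = Slot b j &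
    @y _ (tagged b) = @x _ (tagged a)].
  have := colour_iso (Slot a j); have := is_rung_iso (Slot a j).
  have := code_iso_lt Giso (Atom a) (Slot a j); rewrite Gb /= eqxx.
  case: (G (Slot a j)) => [[k|m]|[c|[c l]]] //= /esym/eqP <- _ [].
  by move/(pcan_inj pickleK) => [tb -> yb].
by exists b; split=> //; [case: (slot 0)|move=> j; case: (slot j)|case: (slot 0)].
Qed.

End IsoInvariants.

Lemma code_iso_struct x y G : order_iso (code_le x) (code_le y) G -> struct_iso x y.
Proof.
move=> Giso; have [G' [K K' G'iso]] := order_iso_inv Giso.
have [g gP] := choice (Elem_iso Giso); have [g' g'P] := choice (Elem_iso G'iso).
exists g; split.
  exists g' => n.
    by have := K (Elem n); rewrite gP g'P => -[].
  by have := K' (Elem n); rewrite g'P gP => -[].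
move=> i t; have [[i' t'] [/= ii' _ slot <-]] := Atom_iso Giso (Tagged (fun i => (ar i).-tuple nat) t).
subst i'; congr (y i _); apply: val_inj => /=.
have gI : injective g.
  by move=> m n mn; have := K (Elem m); rewrite gP mn -gP K => -[].
(* That the [j]-th entry is [n] is the relation of [Elem n] to the [j]-th slot, which the
   isomorphism preserves; so the tuples agree entry by entry. *)
apply: eq_from_onth => j; rewrite onth_map.
have h n : (onth t j == Some n) = (onth t' j == Some (g n)).
  by have := code_iso_lt Giso (Elem n) (Slot (Tagged (fun i => (ar i).-tuple nat) t) j);
    rewrite gP slot.
case E : (onth t j) => [n|] /=.
  by have := h n; rewrite E eqxx => /esym/eqP.
apply: onth_default; rewrite size_tuple.
by have := onthNE t j; rewrite E size_tuple => /esym.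
Qed.

Lemma struct_reducible_aut (P : relspace) (C : set struct) :
  generic_porder P -> struct_class C ->
  borel_reducible (@struct_borel I ar) C (@struct_iso I ar)
    baire_borel (is_aut P) (aut_conj P).
Proof.
move=> HP [sC _].
have sig : sigma_algebra setT (@struct_borel I ar) by exact: smallest_sigma_algebra.
apply: (porder_family_reducible (R := code_le) HP sig sC).
- move=> u v; apply: (trace_meas_or sig); first exact: (trace_meas_const sig sC).
  case: v => [[k|n]|[a|[a j]]].
  (* What lies below a rung, an element or an atom does not depend on the structure, so a constant
     one stands in for it. *)
  + exact: (trace_meas_const sig sC (code_lt (fun _ _ => true) u (Rung k))).
  + exact: (trace_meas_const sig sC (code_lt (fun _ _ => true) u (Elem n))).
  + exact: (trace_meas_const sig sC (code_lt (fun _ _ => true) u (Atom a))).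
  pose X b : struct := fun _ _ => b.
  apply: (@trace_meas_ext _ (@struct_borel I ar) C (fun x => exists b,
      x (tag a) (tagged a) = b /\ code_lt (X b) u (Slot a j))).
    move=> x _; rewrite /code_lt /=; split=> [[b [<-]]//|h].
    by exists (x (tag a) (tagged a)).
  apply: (trace_meas_ex sig) => b.
  apply: (trace_meas_and sig sC); last exact: (trace_meas_const sig sC).
  apply: (sigma_algebra_setI sig sC).
  by apply: sub_sigma_algebra; exists (tag a), (tagged a), b.
- by move=> x _; exact: code_partial_order.
- by move=> x y _ _; split=> [/struct_iso_code//|[G /code_iso_struct]].
Qed.

End StructureCode.

Theorem theorem2p2 (P : relspace) (HP : generic_porder P) :
  borel_reducible rel_borel is_porder porder_iso
                  baire_borel (is_aut P) (aut_conj P) /\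
  borel_complete baire_borel (is_aut P) (aut_conj P).
Proof.
split; first exact: porder_reducible_aut.
split; first exact: aut_conj_reducible_struct.
by move=> I ar C; exact: struct_reducible_aut.
Qed.
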